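(* Let $X$ be the complete cubical complex of dimension $2$ on a finite vertex set $V$ with at least three vertices. Then the first cohomology of $X$ with coefficients in $\mu_2$ is $H^1(X)\cong\mu_2$.
   Context: $\mu_2=\{1,-1\}$ (multiplicative group). The complete cubical complex of dimension $2$ on $V$ has: $0$-cells $X_0=V$; $1$-cells $X_1$ = all unordered pairs of distinct vertices; $2$-cells $X_2$ (squares) = all $4$-element subsets of $V$ endowed with the graph structure of a $4$-cycle; $(ijk\ell)$ denotes the square with edges $ij,jk,k\ell,\ell i$. $C^d(X)$ is the group of functions $X_d\to\mu_2$ under pointwise multiplication. $\delta^0:C^0(X)\to C^1(X)$ is $(\delta^0\alpha)_{ij}=\alpha_i\alpha_j$ and $\delta^1:C^1(X)\to C^2(X)$ is $(\delta^1f)_{ijk\ell}=f_{ij}f_{jk}f_{k\ell}f_{\ell i}$. $Z^1(X)=\ker\delta^1$, $B^1(X)=\operatorname{Im}\delta^0$, $H^1(X)=Z^1(X)/B^1(X)$. *)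

(* Defs.v *)
From HB Require Import structures.
From mathcomp Require Import all_boot all_order all_algebra all_fingroup.

Set Implicit Arguments.
Unset Strict Implicit.
Unset Printing Implicit Defensive.

Import GRing.Theory GroupScope.

Definition mu2 : Type := seq_sub [:: 1%R : int; (-1)%R].

HB.instance Definition _ := Finite.copy mu2 (seq_sub [:: 1%R : int; (-1)%R]).

Fact mu2_one_subproof : (1%R : int) \in [:: 1%R : int; (-1)%R].
Proof. by []. Qed.

Fact mu2_mul_subproof (x y : mu2) :
  (ssval x * ssval y)%R \in [:: 1%R : int; (-1)%R].
Proof.
case: x y => x /= + [y /=]; rewrite !inE.
by case/orP=> /eqP-> /orP[] /eqP->.
Qed.

Definition mu2_one : mu2 := SeqSub mu2_one_subproof.
Definition mu2_mul (x y : mu2) : mu2 := SeqSub (mu2_mul_subproof x y).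

Fact mu2_mulA : associative mu2_mul.
Proof. by move=> x y z; apply: val_inj; rewrite /= mulrA. Qed.

Fact mu2_mul1 : left_id mu2_one mu2_mul.
Proof. by move=> x; apply: val_inj; rewrite /= mul1r. Qed.

Fact mu2_mulV : left_inverse mu2_one (fun x => x) mu2_mul.
Proof.
case=> x x_pm1; apply: val_inj => /=; move: x_pm1; rewrite !inE.
by case/orP=> /eqP->.
Qed.

HB.instance Definition _ :=
  Finite_isGroup.Build mu2 mu2_mulA mu2_mul1 mu2_mulV.

Lemma mu2_mulC (x y : mu2) : x * y = y * x.
Proof. by apply: val_inj; rewrite /= mulrC. Qed.

HB.instance Definition _ :=
  SemiGroup.isCommutativeLaw.Build mu2 *%g mu2_mulC.

Section CompleteCubicalComplex.

Variable V : finType.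

Definition cell0 : finType := V.

Definition cell1 : finType := {e : {set V} | #|e| == 2}.

(* Square with edges ij, jk, kl, li. A 2-cell is a pair of a vertex set and an
   edge set, so (ijkl) = (jkli) = (lkji), and each 4-element subset of V carries
   three distinct 2-cells. *)
Definition is_square (i j k l : V) (q : {set V} * {set cell1}) : bool :=
  [&& uniq [:: i; j; k; l], q.1 == [set i; j; k; l] &
      val @: q.2 == [set [set i; j]; [set j; k]; [set k; l]; [set l; i]]].

Definition cell2 : finType :=
  {q : {set V} * {set cell1} | [exists i, exists j, exists k, exists l,
                                 is_square i j k l q]}.

(* The dependent type of finite functions is the one that carries the pointwise
   group structure. *)
Definition cochain (T : finType) : finGroupType := {dffun forall _ : T, mu2}.

Definition delta0_fun (a : cochain cell0) : cochain cell1 :=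
  [ffun e : cell1 => \prod_(v in val e) a v].

Definition delta1_fun (f : cochain cell1) : cochain cell2 :=
  [ffun s : cell2 => \prod_(e in (val s).2) f e].

Fact delta0_morphM : {in [set: cochain cell0] &,
  {morph delta0_fun : a b / a * b}}.
Proof.
move=> a b _ _; apply/ffunP => e; rewrite !ffunE -big_split.
by apply: eq_bigr => v _; rewrite ffunE.
Qed.

Fact delta1_morphM : {in [set: cochain cell1] &,
  {morph delta1_fun : f g / f * g}}.
Proof.
move=> f g _ _; apply/ffunP => s; rewrite !ffunE -big_split.
by apply: eq_bigr => e _; rewrite ffunE.
Qed.

Definition delta0 : {morphism [set: cochain cell0] >-> cochain cell1} :=
  Morphism delta0_morphM.

Definition delta1 : {morphism [set: cochain cell1] >-> cochain cell2} :=
  Morphism delta1_morphM.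

Lemma delta0E (a : cochain cell0) (e : cell1) (i j : V) :
  i != j -> val e = [set i; j] -> delta0 a e = a i * a j.
Proof.
move=> ij eE; rewrite /= ffunE eE big_setU1 ?big_set1 //.
by rewrite inE.
Qed.

Lemma delta1E (f : cochain cell1) (s : cell2) (i j k l : V)
    (ij jk kl li : cell1) :
  is_square i j k l (val s) ->
  val ij = [set i; j] -> val jk = [set j; k] ->
  val kl = [set k; l] -> val li = [set l; i] ->
  delta1 f s = f ij * f jk * f kl * f li.
Proof.
case/and3P=> Huniq _ /eqP sE Eij Ejk Ekl Eli.
have {}sE : (val s).2 = [set ij; jk; kl; li].
  apply: (imset_inj val_inj); rewrite sE !imsetU !imset_set1.
  by congr (_ :|: _ :|: _ :|: _); congr [set _]; rewrite ?Eij ?Ejk ?Ekl ?Eli.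
have neq (a b : cell1) x : x \in val a -> x \notin val b -> a != b.
  by move=> xa; apply: contraNneq => <-.
move: Huniq; rewrite /= !inE !negb_or => /and4P[/and3P[nij nik nil]].
case/andP=> njk njl nkl _.
have n1 : ij != jk by apply: (neq _ _ i); rewrite ?Eij ?Ejk !inE ?eqxx ?negb_or ?nij ?nik.
have n2 : ij != kl by apply: (neq _ _ i); rewrite ?Eij ?Ekl !inE ?eqxx ?negb_or ?nik ?nil.
have n3 : ij != li.
  by apply: (neq _ _ j); rewrite ?Eij ?Eli !inE ?eqxx ?orbT ?negb_or ?njl // eq_sym.
have n4 : jk != kl by apply: (neq _ _ j); rewrite ?Ejk ?Ekl !inE ?eqxx ?negb_or ?njk ?njl.
have n5 : jk != li.
  by apply: (neq _ _ j); rewrite ?Ejk ?Eli !inE ?eqxx ?orbT ?negb_or ?njl // eq_sym.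
have n6 : kl != li.
  by apply: (neq _ _ k); rewrite ?Ekl ?Eli !inE ?eqxx ?orbT ?negb_or ?nkl // eq_sym.
rewrite /= ffunE sE -!setUA !big_setU1 ?big_set1 /=; first by rewrite !mulgA.
all: by rewrite ?inE ?negb_or ?n1 ?n2 ?n3 ?n4 ?n5 ?n6.
Qed.

Definition Z1 : {group cochain cell1} := ('ker delta1)%G.

Definition B1 : {group cochain cell1} := (delta0 @* [set: cochain cell0])%G.

Lemma B1_subset_Z1 : B1 \subset Z1.
Proof.
apply/subsetP=> _ /morphimP[a _ _ ->]; apply/kerP; first by rewrite inE.
apply/ffunP=> s; rewrite [RHS]ffunE.
have /existsP[i /existsP[j /existsP[k /existsP[l sq]]]] := valP s.
have /and3P[Huniq _ /eqP sE] := sq.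
have edge x y : [set x; y] \in
    [set [set i; j]; [set j; k]; [set k; l]; [set l; i]] ->
    exists e : cell1, val e = [set x; y].
  by rewrite -sE => Hxy; case/imsetP: Hxy => e _ ->; exists e.
have [ij Eij] : exists e : cell1, val e = [set i; j] by apply: edge; rewrite !inE eqxx.
have [jk Ejk] : exists e : cell1, val e = [set j; k] by apply: edge; rewrite !inE eqxx ?orbT.
have [kl Ekl] : exists e : cell1, val e = [set k; l] by apply: edge; rewrite !inE eqxx ?orbT.
have [li Eli] : exists e : cell1, val e = [set l; i] by apply: edge; rewrite !inE eqxx ?orbT.
rewrite (delta1E _ sq Eij Ejk Ekl Eli).
move: Huniq; rewrite /= !inE !negb_or => /and4P[/and3P[nij nik nil]].
case/andP=> njk njl nkl _.
rewrite (delta0E _ nij Eij) (delta0E _ njk Ejk) (delta0E _ nkl Ekl).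
rewrite (@delta0E _ _ l i) // 1?eq_sym //.
have sq1 (x : mu2) : x * x = 1 by apply: mulVg.
have sqK (x y : mu2) : x * (x * y) = y by rewrite mulgA sq1 mul1g.
by rewrite -!mulgA !sqK sq1.
Qed.

Lemma B1_normal : B1 <| Z1.
Proof.
rewrite /normal B1_subset_Z1; apply/cents_norm/centsP => f _ g _.
by apply/ffunP => e; rewrite !ffunE mu2_mulC.
Qed.

Definition H1 : {group coset_of B1} := (Z1 / B1)%G.

End CompleteCubicalComplex.

(* Main.v *)
(** Fix three distinct vertices [a], [b], [c] and send a cocycle to the product
    of its values along the triangle [abc]. The square identity on four
    vertices says that two triangles sharing an edge carry the same product, so
    when the product over [abc] is [1], every triangle through [a] has product
    [1], and [f] is the coboundary of [v |-> f_{av}] (with value [1] at [a]).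
    Hence the kernel is [B^1]; the constant cocycle [-1] is mapped to [-1]. *)
Require Import Defs.
From mathcomp Require Import all_boot all_fingroup.

Set Implicit Arguments.
Unset Strict Implicit.
Unset Printing Implicit Defensive.

Local Open Scope group_scope.

Lemma mu2_mulxx (x : mu2) : x * x = 1.
Proof. exact: mulVg. Qed.

(** Every element is its own inverse; this turns products equal to [1] into the equalities between
    edge values used below. *)
Lemma mu2_mul_eq1 (x y : mu2) : x * y = 1 -> x = y.
Proof. by move=> xy1; rewrite -[x]mulg1 -(mu2_mulxx y) mulgA xy1 mul1g. Qed.

Lemma edge_exists (V : finType) (x y : V) :
  x != y -> exists e : cell1 V, val e = [set x; y].
Proof.
move=> xy; have xy2 : #|[set x; y]| == 2 by rewrite cards2 xy.
by exists (Sub [set x; y] xy2); rewrite SubK.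
Qed.

(* Junk value [1] when [x = y]. *)
Definition edge_val (V : finType) (f : cochain (cell1 V)) (x y : V) : mu2 :=
  if insub [set x; y] is Some e then f e else 1.

Lemma edge_valE (V : finType) (f : cochain (cell1 V)) (e : cell1 V) (x y : V) :
  val e = [set x; y] -> edge_val f x y = f e.
Proof. by rewrite /edge_val => <-; rewrite valK. Qed.

Lemma edge_valC (V : finType) (f : cochain (cell1 V)) (x y : V) :
  edge_val f x y = edge_val f y x.
Proof. by rewrite /edge_val setUC. Qed.

Lemma edge_valM (V : finType) (f g : cochain (cell1 V)) (x y : V) :
  edge_val (f * g) x y = edge_val f x y * edge_val g x y.
Proof. by rewrite /edge_val; case: insub => [e|]; rewrite ?ffunE ?mulg1. Qed.

Lemma edge_val_const (V : finType) (m : mu2) (x y : V) :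
  x != y -> edge_val ([ffun=> m] : cochain (cell1 V)) x y = m.
Proof. by case/edge_exists=> e /edge_valE->; rewrite ffunE. Qed.

Lemma edge_val_delta0 (V : finType) (h : cochain (cell0 V)) (x y : V) :
  x != y -> edge_val (delta0 V h) x y = h x * h y.
Proof.
move=> xy; have [e eE] := edge_exists xy.
by rewrite (edge_valE _ eE) (delta0E h xy eE).
Qed.

Lemma delta1_edge_val (V : finType) (f : cochain (cell1 V)) (s : cell2 V)
    (i j k l : V) :
  is_square i j k l (val s) ->
  delta1 V f s = edge_val f i j * edge_val f j k * edge_val f k l *
                 edge_val f l i.
Proof.
move=> sq; have /and3P[+ _ _] := sq.
rewrite /= !inE !negb_or => /and4P[/and3P[ij _ il] /andP[jk _] kl _].
rewrite eq_sym in il.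
have [eij Eij] := edge_exists ij; have [ejk Ejk] := edge_exists jk.
have [ekl Ekl] := edge_exists kl; have [eli Eli] := edge_exists il.
rewrite (delta1E f sq Eij Ejk Ekl Eli).
by rewrite (edge_valE f Eij) (edge_valE f Ejk) (edge_valE f Ekl)
  (edge_valE f Eli).
Qed.

(** Supplies the 2-cell at which the cocycle condition is evaluated, for any cyclic order of four
    distinct vertices. *)
Lemma square_exists (V : finType) (i j k l : V) :
  uniq [:: i; j; k; l] -> exists s : cell2 V, is_square i j k l (val s).
Proof.
move=> Hu; have := Hu.
rewrite /= !inE !negb_or => /and4P[/and3P[ij _ il] /andP[jk _] kl _].
rewrite eq_sym in il.
have [eij Eij] := edge_exists ij; have [ejk Ejk] := edge_exists jk.
have [ekl Ekl] := edge_exists kl; have [eli Eli] := edge_exists il.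
pose q := ([set i; j; k; l], [set eij; ejk; ekl; eli]).
have sq : is_square i j k l q.
  by rewrite /is_square Hu eqxx !imsetU !imset_set1 Eij Ejk Ekl Eli /=.
have qP : [exists i, exists j, exists k, exists l, is_square i j k l q].
  apply/existsP; exists i; apply/existsP; exists j.
  by apply/existsP; exists k; apply/existsP; exists l.
by exists (Sub q qP); rewrite SubK.
Qed.

Lemma Z1_square (V : finType) (f : cochain (cell1 V)) (i j k l : V) :
  f \in Z1 V -> uniq [:: i; j; k; l] ->
  edge_val f i j * edge_val f j k * edge_val f k l * edge_val f l i = 1.
Proof.
move=> /kerP fZ /square_exists[s sq]; rewrite -(delta1_edge_val f sq).
by rewrite fZ ?inE // ffunE.
Qed.

(** A square has an even number of edges, so the values [x] cancel in pairs. *)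
Lemma const_Z1 (V : finType) (x : mu2) :
  ([ffun=> x] : cochain (cell1 V)) \in Z1 V.
Proof.
apply/kerP; first by rewrite inE.
apply/ffunP => s; rewrite [RHS]ffunE.
have /existsP[i /existsP[j /existsP[k /existsP[l sq]]]] := valP s.
rewrite (delta1_edge_val _ sq); have /and3P[+ _ _] := sq.
rewrite /= !inE !negb_or => /and4P[/and3P[ij _ il] /andP[jk _] kl _].
by rewrite !edge_val_const // 1?eq_sym // mu2_mulxx mul1g mu2_mulxx.
Qed.

Definition triangle (V : finType) (a b c : V) (f : cochain (cell1 V)) : mu2 :=
  edge_val f a b * edge_val f b c * edge_val f c a.

Lemma triangleM (V : finType) (a b c : V) :
  {in [set: cochain (cell1 V)] &, {morph triangle a b c : f g / f * g}}.
Proof.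
move=> f g _ _; rewrite /triangle !edge_valM.
have mulACA (x y z t : mu2) : x * y * (z * t) = x * z * (y * t).
  by rewrite -!mulgA; congr (_ * _); rewrite !mulgA (mu2_mulC y).
by rewrite [RHS]mulACA; congr (_ * _); rewrite mulACA.
Qed.

Definition triangle_morphism (V : finType) (a b c : V) :
    {morphism [set: cochain (cell1 V)] >-> mu2} :=
  Morphism (@triangleM V a b c).

Lemma triangle_flip (V : finType) (f : cochain (cell1 V)) (a b c : V) :
  triangle a b c f = triangle a c b f.
Proof.
rewrite /triangle (edge_valC f a c) (edge_valC f c b) (edge_valC f b a).
by rewrite mu2_mulC -mulgA; congr (_ * _); rewrite mu2_mulC.
Qed.

(** Once the common edge [ab] is cancelled, the remaining four edges [bc], [ca], [ad], [db] form a
    square, on which a cocycle has product [1]. *)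
Lemma triangle_shift (V : finType) (f : cochain (cell1 V)) (a b c d : V) :
  f \in Z1 V -> uniq [:: b; c; a; d] -> triangle a b c f = triangle a b d f.
Proof.
move=> fZ /(Z1_square fZ) sq; rewrite /triangle -!mulgA; congr (_ * _).
rewrite (edge_valC f b d) (edge_valC f d a) mu2_mulC.
by rewrite [RHS]mu2_mulC mu2_mulC; apply: mu2_mul_eq1; rewrite !mulgA.
Qed.

(** Each vertex of the triangle lies on two of its edges, so its value occurs twice. *)
Lemma triangle_delta0 (V : finType) (h : cochain (cell0 V)) (a b c : V) :
  a != b -> b != c -> c != a -> triangle a b c (delta0 V h) = 1.
Proof.
move=> ab bc ca; rewrite /triangle !edge_val_delta0 //.
have mulxxK (x y : mu2) : x * (x * y) = y by rewrite mulgA mu2_mulxx mul1g.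
by rewrite -!mulgA !mulxxK mu2_mulxx.
Qed.

Lemma triangle_eq1 (V : finType) (f : cochain (cell1 V)) (a b c u v : V) :
  f \in Z1 V -> a != b -> b != c -> c != a -> triangle a b c f = 1 ->
  a != u -> u != v -> v != a -> triangle a u v f = 1.
Proof.
move=> fZ ab bc ca abc1 au uv va.
(* First move only the third vertex, keeping the edge [ab]. *)
have abw1 w : b != w -> w != a -> triangle a b w f = 1.
  move=> bw wa; have [-> //|wc] := eqVneq w c.
  rewrite (@triangle_shift _ _ _ _ _ c) //= !inE !negb_or bw wc wa.
  by rewrite (eq_sym b a) ab bc eq_sym ca.
have [ub|ub] := eqVneq u b; first by rewrite ub abw1 // -ub.
have [vb|vb] := eqVneq v b.
  by rewrite vb triangle_flip abw1 1?eq_sym // -vb.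
(* Now [a], [b], [u], [v] are distinct: pass from [auv] to [aub] along the edge [au], which reduces
   to the triangles on [ab]. *)
rewrite (@triangle_shift _ _ _ _ _ b) //.
  by rewrite triangle_flip abw1 1?eq_sym.
by rewrite /= !inE !negb_or uv ub va vb (eq_sym u a) au ab.
Qed.

Lemma ker_triangle (V : finType) (a b c : V) :
  a != b -> b != c -> c != a ->
  'ker_(Z1 V) (triangle_morphism a b c) = B1 V.
Proof.
move=> ab bc ca; apply/setP => f; rewrite inE; apply/andP/idP; last first.
  move=> fB; split; first exact: (subsetP (B1_subset_Z1 V)).
  case/morphimP: fB => h _ _ ->.
  by apply/kerP; rewrite ?inE //; apply: triangle_delta0.
case=> fZ /kerP; rewrite inE => /(_ isT) abc1.
pose h : cochain (cell0 V) := [ffun v => edge_val f a v].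
(* The default value of [edge_val] makes [h a = 1], which settles the edges containing [a]. *)
have edge_aa : edge_val f a a = 1.
  rewrite /edge_val; case: insubP => // e + _.
  by rewrite setUid cards1.
suff -> : f = delta0 V h by rewrite mem_morphim ?inE.
apply/ffunP => e; have /cards2P[u [v [uv eE]]] : #|val e| == 2 by exact: (valP e).
rewrite (delta0E h uv eE) !ffunE -(edge_valE f eE).
have [->|ua] := eqVneq u a; first by rewrite edge_aa mul1g.
have [->|va] := eqVneq v a; first by rewrite edge_aa mulg1 edge_valC.
(* For an edge [uv] avoiding [a], the claim is that the triangle [auv] has product [1]. *)
rewrite eq_sym in ua; apply: mu2_mul_eq1.
rewrite (edge_valC f a v) mu2_mulC -mulgA [X in _ * X]mu2_mulC mulgA.
exact: (triangle_eq1 fZ ab bc ca abc1 ua uv va).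
Qed.

(** A triangle has three edges, so the constant cocycle [x] is sent to [x * x * x = x]. *)
Lemma triangle_surj (V : finType) (a b c : V) :
  a != b -> b != c -> c != a ->
  triangle_morphism a b c @* Z1 V = [set: mu2].
Proof.
move=> ab bc ca; apply/setP => x; rewrite [RHS]inE; apply/morphimP.
exists ([ffun=> x] : cochain (cell1 V)); [by rewrite inE | exact: const_Z1 |].
by rewrite /= /triangle !edge_val_const // mu2_mulxx mul1g.
Qed.

Theorem corollary5p4 (V : finType) (hV : 3 <= #|V|) :
  (H1 V \isog [set: mu2])%g.
Proof.
have [a [b [c [_ [ab bc ca]]]]] : exists a b c : V,
    [/\ a \in V, b \in V & c \in V] /\ [/\ a != b, b != c & c != a].
  exact/card_gt2P.
(* The morphism is defined on all 1-cochains, so the first isomorphism theorem is applied to its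
   restriction to [Z1 V]. *)
have := first_isog_loc (triangle_morphism a b c) (subsetT (Z1 V)).
by rewrite ker_triangle // triangle_surj.
Qed.
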